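(* Let $y$ be a class with prompt $\mathcal{C}_y$, let $t \ge 1$, and let $\mathbf{x}_0, \mathbf{x}_1, \dots, \mathbf{x}_t \in \mathbb{R}^d$ be a trajectory of the conditional DDIM inversion of a real image $\mathbf{x}_0$, i.e. for every $1 \le k \le t$ the deterministic conditional DDIM relation (noise strength $\sigma_k = 0$, guidance strength $\gamma = 1$) holds: $$\mathbf{x}_{k-1} = \sqrt{\frac{\alpha_{k-1}}{\alpha_k}}\, \mathbf{x}_k - \sqrt{\alpha_{k-1}}\, \psi(\alpha_k, \alpha_{k-1}, 0)\, \epsilon_\theta(\mathbf{x}_k, k, \mathcal{C}_y).$$ For $1 \le k \le t$ put $\delta_k = \epsilon_\theta(\mathbf{x}_k, k, \mathcal{C}_y) - \epsilon_\theta(\mathbf{x}_{k-1}, k, \mathcal{C}_y)$, and for $0 \le i \le t-1$ put $s_i = \sqrt{\alpha_t (1 - \bar\alpha_{i+1})}\, \psi(\alpha_{i+1}, \alpha_i, 0)$. Then $$\mathbf{x}_t = \sqrt{\alpha_t}\, \mathbf{x}_0 - \sum_{i=0}^{t-1} \left[ \nabla_{\mathbf{x}_i} \log p_\theta(\mathbf{x}_i)^{s_i} + \nabla_{\mathbf{x}_i} \log p_\theta(y \mid \mathbf{x}_i)^{s_i} \right] + \sum_{i=0}^{t-1} \frac{s_i}{\sqrt{1 - \bar\alpha_{i+1}}}\, \delta_{i+1}.$$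
   Context: Noise schedule: $\beta_1, \dots, \beta_T \in (0,1)$ is a fixed variance schedule, $\alpha_k = \prod_{i=1}^k (1 - \beta_i)$ for $0 \le k \le T$ (so $\alpha_0 = 1$ as an empty product), and $\bar\alpha_k = \prod_{i=0}^k \alpha_i$; here $t \le T$. The schedule constant at zero noise strength is $$\psi(\alpha_k, \alpha_{k-1}, 0) = \sqrt{\frac{1}{\alpha_k} - 1} - \sqrt{\frac{1}{\alpha_{k-1}} - 1}.$$ Model: $p_\theta(\mathbf{x})$ is a positive differentiable density on $\mathbb{R}^d$ (the data distribution parameterized by $\theta$), $p_\theta(\mathbf{x} \mid y)$ is the positive differentiable conditional density given class $y$ (conditioning on the prompt $\mathcal{C}_y$ is the same as conditioning on $y$), $p_\theta(y) > 0$ is the class probability, and $p_\theta(y \mid \mathbf{x}) = p_\theta(\mathbf{x} \mid y)\, p_\theta(y) / p_\theta(\mathbf{x})$ (Bayes' rule). The conditional diffusion noise estimator $\epsilon_\theta(\cdot, k, \mathcal{C}_y) : \mathbb{R}^d \to \mathbb{R}^d$ is related to the score by the identity, for all $\mathbf{x} \in \mathbb{R}^d$ and $1 \le k \le T$, $$\epsilon_\theta(\mathbf{x}, k, \mathcal{C}_y) = -\sqrt{1 - \bar\alpha_k}\, \nabla_{\mathbf{x}} \log p_\theta(\mathbf{x} \mid y).$$ Notation: $\nabla_{\mathbf{x}_i} \log p_\theta(\cdot)^{s_i}$ denotes the gradient of $\log\big(p_\theta(\cdot)^{s_i}\big)$, i.e. $s_i \nabla_{\mathbf{x}} \log p_\theta(\cdot)$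 evaluated at $\mathbf{x} = \mathbf{x}_i$ ($s_i$ is treated as a constant). *)

(* Defs.v *)
From mathcomp Require Import all_boot all_order all_algebra.
From mathcomp Require Import all_classical all_reals all_analysis.
Import Order.TTheory GRing.Theory Num.Theory numFieldNormedType.Exports.

Set Implicit Arguments.
Unset Strict Implicit.
Unset Printing Implicit Defensive.

Local Open Scope ring_scope.

(* Lebesgue integral over R^d of a nonnegative function, as an iterated
   integral in the successive coordinates (Tonelli); for d = 0 it is evaluation
   at the unique point of R^0. *)
Fixpoint integral_rV (R : realType) (d : nat) : ('rV[R]_d -> \bar R) -> \bar R :=
  match d with
  | 0 => fun f => f 0
  | d'.+1 => fun f =>
      (\int[@lebesgue_measure R]_(a in setT)
         integral_rV (fun v : 'rV[R]_d' => f (row_mx (a%:M : 'rV[R]_1) v)))%E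
  end.

Definition pos_diff_density (R : realType) (d : nat) (p : 'rV[R]_d -> R) : Prop :=
  [/\ forall x, 0 < p x,
      forall x, differentiable p x &
      integral_rV (fun x => (p x)%:E) = 1%E].

Definition grad (R : realType) (d : nat) (f : 'rV[R]_d -> R) (x : 'rV[R]_d) :
    'rV[R]_d :=
  \row_j 'D_(delta_mx 0 j) f x.

(* The variances are beta 1, ..., beta T; other values of beta are not used. *)
Definition alpha (R : realType) (beta : nat -> R) (k : nat) : R :=
  \prod_(1 <= i < k.+1) (1 - beta i).

(* The product of the alpha i, not of the 1 - beta i. *)
Definition alpha_bar (R : realType) (beta : nat -> R) (k : nat) : R :=
  \prod_(0 <= i < k.+1) alpha beta i.

(* psi (a, b, 0), i.e. at noise strength zero. *)
Definition psi0 (R : realType) (a b : R) : R :=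
  Num.sqrt (a^-1 - 1) - Num.sqrt (b^-1 - 1).

(* x_0, ..., x_t follow the deterministic conditional DDIM relation (noise
   strength 0, guidance strength 1) with noise estimator eps x k c. *)
Definition ddim_inversion (R : realType) (d : nat) (C : Type)
    (beta : nat -> R) (eps : 'rV[R]_d -> nat -> C -> 'rV[R]_d) (y : C)
    (t : nat) (x : nat -> 'rV[R]_d) : Prop :=
  forall k, (1 <= k <= t)%N ->
    x k.-1 = Num.sqrt (alpha beta k.-1 / alpha beta k) *: x k
             - (Num.sqrt (alpha beta k.-1)
                * psi0 (alpha beta k) (alpha beta k.-1)) *: eps (x k) k y.

Definition ddim_delta (R : realType) (d : nat) (C : Type)
    (eps : 'rV[R]_d -> nat -> C -> 'rV[R]_d) (y : C)
    (x : nat -> 'rV[R]_d) (k : nat) : 'rV[R]_d :=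
  eps (x k) k y - eps (x k.-1) k y.

Definition ddim_s (R : realType) (beta : nat -> R) (t i : nat) : R :=
  Num.sqrt (alpha beta t * (1 - alpha_bar beta i.+1))
  * psi0 (alpha beta i.+1) (alpha beta i).

(* Main.v *)
(* With u_k = x_k / sqrt alpha_k the DDIM relation reads
   u_k = u_{k-1} + psi_k eps (x_k, k), which telescopes; then
   eps (x_k, k) = eps (x_{k-1}, k) + delta_k, and by Bayes' rule the score
   grad log p (. | y) splits as grad log p + grad log p (y | .), the constant
   log p (y) having gradient zero. *)
Require Import Defs.
From mathcomp Require Import all_boot all_order all_algebra.
From mathcomp Require Import all_classical all_reals all_analysis.
Import Order.TTheory GRing.Theory Num.Theory numFieldNormedType.Exports.

Set Implicit Arguments.
Unset Strict Implicit.
Unset Printing Implicit Defensive.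

Local Open Scope ring_scope.

Lemma differentiable_ln_comp (R : realType) (d : nat) (f : 'rV[R]_d -> R)
    (z : 'rV[R]_d) :
  0 < f z -> differentiable f z -> differentiable (fun z => ln (f z)) z.
Proof.
move=> fz df; apply: differentiable_comp => //.
by apply/derivable1_diffP; have [] := is_derive1_ln fz.
Qed.

Lemma gradD (R : realType) (d : nat) (f g : 'rV[R]_d -> R) (z : 'rV[R]_d) :
  differentiable f z -> differentiable g z ->
  grad (fun w => f w + g w) z = grad f z + grad g z.
Proof.
move=> df dg; apply/rowP => j; rewrite !mxE.
by rewrite deriveD //; exact: diff_derivable.
Qed.

Lemma gradZ (R : realType) (d : nat) (s : R) (f : 'rV[R]_d -> R)
    (z : 'rV[R]_d) :
  differentiable f z -> grad (fun w => s * f w) z = s *: grad f z.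
Proof.
move=> df; apply/rowP => j; rewrite !mxE.
by rewrite (deriveZ (f := f)) //; exact: diff_derivable.
Qed.

Lemma grad_cst (R : realType) (d : nat) (c : R) (z : 'rV[R]_d) :
  grad (fun=> c) z = 0.
Proof. by apply/rowP => j; rewrite !mxE derive_cst. Qed.

(** Pointwise, [ln r = ln q + ln c - ln p]: the prior score cancels the [- ln p] part of the
    posterior score, and the normalising constant [c] drops out on differentiation. The exponent [s]
    is a constant factor throughout. *)
Lemma grad_ln_bayes (R : realType) (d : nat) (s c : R)
    (p q r : 'rV[R]_d -> R) (z : 'rV[R]_d) :
  (forall w, 0 < p w) -> (forall w, 0 < q w) -> 0 < c ->
  differentiable p z -> differentiable q z ->
  (forall w, r w = q w * c / p w) ->
  grad (fun w => ln (p w `^ s)) z + grad (fun w => ln (r w `^ s)) z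
  = s *: grad (fun w => ln (q w)) z.
Proof.
move=> p0 q0 c0 dp dq rE.
have dlp := differentiable_ln_comp (p0 z) dp.
have dlq := differentiable_ln_comp (q0 z) dq.
have -> : (fun w => ln (p w `^ s)) = (fun w => s * ln (p w)).
  by apply/funext => w; rewrite ln_powR.
(* Positivity of [p] and [q] at every point, not just at [z], makes this an equality of functions,
   so it can be rewritten under [grad]. *)
have -> : (fun w => ln (r w `^ s))
    = (fun w => s * ln (q w) + (s * ln c + - s * ln (p w))).
  apply/funext => w; rewrite ln_powR rE lnM ?posrE ?invr_gt0 ?mulr_gt0//.
  by rewrite lnM ?posrE// lnV ?posrE// !mulrDr mulrN mulNr addrA.
have dZ (k : R) (f : 'rV[R]_d -> R) : differentiable f z ->
    differentiable (fun w => k * f w) z by move=> df; exact: differentiableZ.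
have dc : differentiable (fun=> s * ln c : R) z by exact: differentiable_cst.
rewrite gradD; [|exact: dZ|apply: differentiableD => //; exact: dZ].
rewrite gradD; [|exact: dc|exact: dZ].
by rewrite grad_cst !gradZ// add0r scaleNr addrC subrK.
Qed.

Lemma alpha_gt0 (R : realType) (T : nat) (beta : nat -> R) :
  (forall k, (1 <= k <= T)%N -> 0 < beta k < 1) ->
  forall k, (k <= T)%N -> 0 < alpha beta k.
Proof.
move=> hb k kT; rewrite /alpha big_nat_cond; apply: prodr_gt0 => i.
rewrite andbT ltnS => /andP[i0 ik].
have iT : (1 <= i <= T)%N by rewrite i0 (leq_trans ik kT).
by have /andP[_] := hb i iT; rewrite subr_gt0.
Qed.

Lemma alphaS (R : realType) (beta : nat -> R) (k : nat) :
  alpha beta k.+1 = alpha beta k * (1 - beta k.+1).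
Proof. by rewrite /alpha big_nat_recr. Qed.

Lemma alpha_lt1 (R : realType) (T : nat) (beta : nat -> R) :
  (forall k, (1 <= k <= T)%N -> 0 < beta k < 1) ->
  forall k, (k < T)%N -> alpha beta k.+1 < 1.
Proof.
move=> hb; elim=> [|k IH] kT; have /andP[b0 b1] := hb _.+1 kT.
  by rewrite alphaS /alpha big_geq// mul1r ltrBlDr ltrDl.
rewrite alphaS mulr_ilt1 ?IH ?(ltnW kT) ?subr_ge0 ?(ltW b1) //.
  exact/ltW/(alpha_gt0 hb)/ltnW.
by rewrite ltrBlDr ltrDl.
Qed.

(** The last factor [alpha beta k.+1] is strictly below 1 and the earlier ones lie in [0, 1]. The
    index starts at 1 because [alpha_bar beta 0] equals 1. This makes division by
    [Num.sqrt (1 - alpha_bar beta i.+1)] legitimate. *)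
Lemma alpha_bar_lt1 (R : realType) (T : nat) (beta : nat -> R) :
  (forall k, (1 <= k <= T)%N -> 0 < beta k < 1) ->
  forall k, (k < T)%N -> alpha_bar beta k.+1 < 1.
Proof.
move=> hb k kT.
have ge0 : 0 <= alpha_bar beta k.
  rewrite /alpha_bar big_nat_cond; apply: prodr_ge0 => i.
  rewrite andbT ltnS => /= ik; apply/ltW/(alpha_gt0 hb).
  exact: leq_trans ik (ltnW kT).
have le1 : alpha_bar beta k <= 1.
  rewrite /alpha_bar big_nat_cond; apply: prodr_ile1 => -[|i].
    by rewrite /alpha big_geq// ler01 lexx.
  rewrite andbT ltnS => /= ik; have iT := leq_trans ik (ltnW kT).
  by rewrite (ltW (alpha_gt0 hb iT)) (ltW (alpha_lt1 hb iT)).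
rewrite /alpha_bar big_nat_recr//= -/(alpha_bar beta k).
apply: le_lt_trans (alpha_lt1 hb kT).
by rewrite ler_piMl// ltW// (alpha_gt0 hb).
Qed.

(** The telescoped recursion, by induction on [t]. The noise is still evaluated at the later point
    [x i.+1]; trading it for [x i] is left to the theorem. *)
Lemma ddim_inversion_sum (R : realType) (d : nat) (C : Type) (T : nat)
    (beta : nat -> R) (eps : 'rV[R]_d -> nat -> C -> 'rV[R]_d) (y : C)
    (t : nat) (x : nat -> 'rV[R]_d) :
  (forall k, (1 <= k <= T)%N -> 0 < beta k < 1) -> (t <= T)%N ->
  ddim_inversion beta eps y t x ->
  x t = Num.sqrt (alpha beta t) *: x 0%N
    + \sum_(0 <= i < t) (Num.sqrt (alpha beta t)
        * psi0 (alpha beta i.+1) (alpha beta i)) *: eps (x i.+1) i.+1 y.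
Proof.
move=> hb; elim: t => [|t IH] tT hx.
  by rewrite big_geq// addr0 /alpha big_geq// sqrtr1 scale1r.
have hxt : ddim_inversion beta eps y t x.
  by move=> k /andP[k1 kt]; apply: hx; rewrite k1 leqW.
have {}IH := IH (ltnW tT) hxt.
have at0 := alpha_gt0 hb (ltnW tT); have aS0 := alpha_gt0 hb tT.
set u := Num.sqrt (alpha beta t); set v := Num.sqrt (alpha beta t.+1).
have u0 : u != 0 by rewrite gt_eqF// sqrtr_gt0.
have v0 : v != 0 by rewrite gt_eqF// sqrtr_gt0.
have xt := hx t.+1 (leqnn _).
rewrite /= sqrtrM ?(ltW at0)// sqrtrV ?(ltW aS0)// -/u -/v in xt.
(* The DDIM relation is solved for the later point by multiplying through by [v / u]. *)
have -> : x t.+1 = (v / u) *: x t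
    + (v * psi0 (alpha beta t.+1) (alpha beta t)) *: eps (x t.+1) t.+1 y.
  by rewrite xt scalerBr !scalerA !(mulrA (v / u)) divfK// divff// scale1r subrK.
(* Every coefficient from the induction hypothesis carries the factor [u], which [v / u] turns into
   [v]. *)
rewrite IH scalerDr scalerA divfK// big_nat_recr//= addrA scaler_sumr.
congr (_ + _ + _); apply: eq_bigr => i _.
by rewrite scalerA mulrA divfK.
Qed.

Theorem theorem3p1 (R : realType) (d : nat) (C : Type) (T : nat)
  (beta : nat -> R)
  (p : 'rV[R]_d -> R)               (* p(x) *)
  (p_cond : 'rV[R]_d -> C -> R)     (* p(x | y) *)
  (p_class : C -> R)                (* p(y) *)
  (p_post : C -> 'rV[R]_d -> R)     (* p(y | x) *)
  (eps : 'rV[R]_d -> nat -> C -> 'rV[R]_d)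
  (y : C) (t : nat) (x : nat -> 'rV[R]_d)
  (hbeta : forall k, (1 <= k <= T)%N -> 0 < beta k < 1)
  (hp : pos_diff_density p)
  (hp_cond : pos_diff_density (fun z => p_cond z y))
  (hp_class : 0 < p_class y <= 1)
  (bayes : forall z, p_post y z = p_cond z y * p_class y / p z)
  (heps : forall (z : 'rV[R]_d) (k : nat), (1 <= k <= T)%N ->
     eps z k y = - Num.sqrt (1 - alpha_bar beta k)
                   *: grad (fun z' => ln (p_cond z' y)) z)
  (ht : (1 <= t <= T)%N)
  (hx : ddim_inversion beta eps y t x) :
  x t = Num.sqrt (alpha beta t) *: x 0%N
    - \sum_(0 <= i < t)
        (grad (fun z => ln (p z `^ ddim_s beta t i)) (x i)
         + grad (fun z => ln (p_post y z `^ ddim_s beta t i)) (x i))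
    + \sum_(0 <= i < t)
        (ddim_s beta t i / Num.sqrt (1 - alpha_bar beta i.+1))
          *: ddim_delta eps y x i.+1.
Proof.
have /andP[_ tT] := ht; have [p0 dp _] := hp; have [q0 dq _] := hp_cond.
have /andP[c0 _] := hp_class.
rewrite (ddim_inversion_sum hbeta tT hx) -addrA; congr (_ + _).
(* With the [x 0] term removed, the two sides agree summand by summand. *)
rewrite -sumrN -big_split/=; apply: eq_big_nat => i /andP[_ it].
have iT := leq_trans it tT.
rewrite (grad_ln_bayes _ p0 q0 c0 (dp _) (dq _) bayes).
set g := grad _ _; set r := Num.sqrt (1 - alpha_bar beta i.+1).
have r0 : r != 0.
  by rewrite gt_eqF// sqrtr_gt0 subr_gt0 (alpha_bar_lt1 hbeta).
have sE : ddim_s beta t i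
    = Num.sqrt (alpha beta t) * psi0 (alpha beta i.+1) (alpha beta i) * r.
  by rewrite /ddim_s sqrtrM ?(ltW (alpha_gt0 hbeta tT))// -/r mulrAC.
rewrite sE mulfK// /ddim_delta /= (heps (x i) i.+1)// -/g -/r.
(* Since [eps (x i) i.+1 y] is [- r *: g], its share of [ddim_delta] contributes [+ s_i *: g],
   cancelling the score term [- s_i *: g]; only the [eps (x i.+1)] term survives. *)
by rewrite scaleNr opprK scalerDr scalerA addrCA addNr addr0.
Qed.
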